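(* Let $\varphi$ be a polynomial with real coefficients, of even degree and without fixed points in $\mathbb{R}$ (i.e. $\varphi(x)\neq x$ for all $x\in\mathbb{R}$). Then $\sigma(C_\varphi)=\{0\}$.
   Context: $\mathcal{S}(\mathbb{R})$ is the Fréchet space of (complex-valued) smooth rapidly decreasing functions on $\mathbb{R}$ (Schwartz space). For a non-constant real polynomial $\varphi$, the composition operator $C_\varphi:\mathcal{S}(\mathbb{R})\to\mathcal{S}(\mathbb{R})$, $C_\varphi f=f\circ\varphi$, is well defined, linear and continuous. For a continuous linear operator $T:X\to X$ on a Fréchet space $X$, the spectrum $\sigma(T)$ is the set of all $\lambda\in\mathbb{C}$ such that $T-\lambda I:X\to X$ does not admit a continuous linear inverse. *)

(* Defs.v *)
From HB Require Import structures.
From mathcomp Require Import all_boot all_order all_algebra.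
From mathcomp Require Import all_classical all_reals all_analysis.
From mathcomp Require Import complex.
From mathcomp Require Import ring lra.
Set Implicit Arguments.
Unset Strict Implicit.
Unset Printing Implicit Defensive.
Import Order.TTheory GRing.Theory Num.Theory.
Import numFieldNormedType.Exports.
Local Open Scope ring_scope.
Local Open Scope classical_set_scope.
Local Open Scope complex_scope.

Definition spectrum (K : numFieldType) (X : preTopologicalLmodType K)
    (T : {linear X -> X}) : set K :=
  [set lambda | ~ exists S : {linear X -> X},
    [/\ continuous S,
        cancel (fun x => T x - lambda *: x) S &
        cancel S (fun x => T x - lambda *: x)]].

Section Smooth.
Variable R : realType.
Implicit Types (u v : R -> R) (f g : R -> R[i]).

Definition rsmooth u := forall n x, derivable (derive1n n u) x 1.

(* Complex-valued functions are differentiated componentwise. *)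
Definition smooth f := rsmooth (@complex.Re R \o f) /\ rsmooth (@complex.Im R \o f).

Definition cderiven n f : R -> R[i] :=
  fun x => derive1n n (@complex.Re R \o f) x +i* derive1n n (@complex.Im R \o f) x.

Definition weighted k n f : R -> R :=
  fun x => `|x| ^+ k * ComplexField.Normc.normc (cderiven n f x).

Definition schwartz : {pred (R -> R[i])} :=
  [pred f | `[< smooth f /\
    forall k n, exists M : R, forall x, weighted k n f x <= M >]].

(* Real-valued rapid decrease and its Schwartz class: auxiliary, see [schwartzP]. *)
Definition rdecr v := forall k, exists M : R, forall x, `|x| ^+ k * `|v x| <= M.

Definition rschwartz u := rsmooth u /\ forall n, rdecr (derive1n n u).

Lemma rdecrD u v : rdecr u -> rdecr v -> rdecr (u + v).
Proof.
move=> hu hv k; have [M hM] := hu k; have [N hN] := hv k; exists (M + N) => x.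
apply: le_trans (lerD (hM x) (hN x)); rewrite -mulrDr ler_wpM2l ?exprn_ge0//.
exact: ler_normD.
Qed.

Lemma rdecrZ c u : rdecr u -> rdecr (c *: u).
Proof.
move=> hu k; have [M hM] := hu k; exists (`|c| * M) => x.
by rewrite [(c *: u) x]/(_ * _) normrM mulrCA ler_wpM2l.
Qed.

Lemma derive1nD u v n : rsmooth u -> rsmooth v ->
  derive1n n (u + v) = derive1n n u + derive1n n v.
Proof.
move=> hu hv; elim: n => [//|n IH].
rewrite !derive1nS IH; apply/funext => x.
by rewrite derive1E (deriveD (hu n x) (hv n x)) -!derive1E.
Qed.

Lemma derive1nZ c u n : rsmooth u -> derive1n n (c *: u) = c *: derive1n n u.
Proof.
move=> hu; elim: n => [//|n IH].
rewrite !derive1nS IH; apply/funext => x.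
by rewrite derive1E (deriveZ c (hu n x)) -!derive1E.
Qed.

Lemma rschwartzD u v : rschwartz u -> rschwartz v -> rschwartz (u + v).
Proof.
move=> [su du] [sv dv]; split=> n; rewrite derive1nD//.
- by move=> x; apply: derivableD; [exact: su|exact: sv].
- exact: rdecrD.
Qed.

Lemma rschwartzZ c u : rschwartz u -> rschwartz (c *: u).
Proof.
move=> [su du]; split=> n; rewrite derive1nZ//.
- by move=> x; apply: derivableZ; exact: su.
- exact: rdecrZ.
Qed.

Lemma schwartzP f : reflect
  (rschwartz (@complex.Re R \o f) /\ rschwartz (@complex.Im R \o f)) (f \in schwartz).
Proof.
apply: (iffP (asboolP _)) => [[[sR sI] dec]|[[sR dR] [sI dI]]].
  split; split=> // n k; have [M hM] := dec k n; exists M => x;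
    apply: le_trans (hM x); rewrite ler_wpM2l ?exprn_ge0//=;
    by rewrite -sqrtr_sqr ler_wsqrtr// ?lerDl ?lerDr sqr_ge0.
split=> // k n; have [M hM] := dR n k; have [N hN] := dI n k.
exists (M + N) => x; apply: le_trans (lerD (hM x) (hN x)).
rewrite -mulrDr ler_wpM2l ?exprn_ge0//= -[leRHS]ger0_norm ?addr_ge0//.
rewrite -sqrtr_sqr ler_wsqrtr// sqrrD !real_normK ?num_real//.
by rewrite lerD2r lerDl mulrn_wge0 ?mulr_ge0.
Qed.

Lemma schwartz_submod : submod_closed schwartz.
Proof.
have R0 : rschwartz (0 : R -> R).
  have D0 n : derive1n n (0 : R -> R) = 0.
    elim: n => [//|n IH]; rewrite derive1nS IH; apply/funext => x.
    by rewrite derive1E derive_cst.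
  split=> n; rewrite D0; first by move=> x; exact: derivable_cst.
  by move=> k; exists 0 => x; rewrite normr0 mulr0.
split; first by apply/schwartzP; split.
move=> c f g /schwartzP[fR fI] /schwartzP[gR gI]; apply/schwartzP; split.
- rewrite (_ : _ \o _ = (complex.Re c *: (@complex.Re R \o f) +
    (- complex.Im c) *: (@complex.Im R \o f)) + (@complex.Re R \o g)).
    by apply: rschwartzD => //; apply: rschwartzD; exact: rschwartzZ.
  apply/funext => x /=; rewrite !fctE /=.
  by case: (f x) (g x) c => [a b] [a' b'] [a'' b'']/=; rewrite scaleNr.
- rewrite (_ : _ \o _ = (complex.Re c *: (@complex.Im R \o f) +
    complex.Im c *: (@complex.Re R \o f)) + (@complex.Im R \o g)).
    by apply: rschwartzD => //; apply: rschwartzD; exact: rschwartzZ.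
  apply/funext => x /=; rewrite !fctE /=.
  by case: (f x) (g x) c => [a b] [a' b'] [a'' b'']/=.
Qed.

HB.instance Definition _ :=
  GRing.isSubmodClosed.Build R[i] (R -> R[i]) schwartz schwartz_submod.

End Smooth.

Record schwartzSpace (R : realType) := SchwartzFun {
  schwartz_fun :> R -> R[i];
  _ : schwartz_fun \in schwartz (R := R) }.

HB.instance Definition _ (R : realType) :=
  [isSub for @schwartz_fun R].
HB.instance Definition _ (R : realType) :=
  [Choice of schwartzSpace R by <:].
HB.instance Definition _ (R : realType) :=
  [SubChoice_isSubLmodule of schwartzSpace R by <:].

Definition seminorm (R : realType) (k n : nat) (f : R -> R[i]) : R :=
  sup (range (weighted k n f)).

(* Sub-base of all open seminorm balls, indexed by the balls themselves; see
   [nbhs_schwartzE] for the resulting neighbourhoods. *)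
HB.instance Definition _ (R : realType) :=
  @isSubBaseTopological.Build (schwartzSpace R) (set (schwartzSpace R))
    [set B | exists k n (f : schwartzSpace R) (e : R), 0 < e /\
       B = [set g : schwartzSpace R | seminorm k n (g - f : schwartzSpace R) < e]]
    id.

Section SchwartzTopology.
Variable R : realType.
Implicit Types f g h : schwartzSpace R.

Lemma le_seminorm k n f x : weighted k n f x <= seminorm k n f.
Proof.
have /asboolP[_ /(_ k n)[M hM]] := valP f.
by apply: ub_le_sup; [exists M => _ [y _ <-]|exists x].
Qed.

Lemma seminorm_le k n (f : R -> R[i]) M :
  (forall x, weighted k n f x <= M) -> seminorm k n f <= M.
Proof.
move=> hM; apply: ge_sup; first by exists (weighted k n f 0); exists 0.
by move=> _ [y _ <-].
Qed.

Lemma cderivenD n f g x :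
  cderiven n (f + g : schwartzSpace R) x = cderiven n f x + cderiven n g x.
Proof.
have /asboolP[[fR fI] _] := valP f; have /asboolP[[gR gI] _] := valP g.
rewrite /cderiven (_ : @complex.Re R \o _ =
  (@complex.Re R \o f : R -> R) + (@complex.Re R \o g)); last first.
  by apply/funext => y /=; rewrite !fctE/=; case: (f y) (g y) => [? ?] [].
rewrite (_ : @complex.Im R \o _ =
  (@complex.Im R \o f : R -> R) + (@complex.Im R \o g)); last first.
  by apply/funext => y /=; rewrite !fctE/=; case: (f y) (g y) => [? ?] [].
by rewrite !derive1nD.
Qed.

Lemma seminormD k n f g :
  seminorm k n (f + g : schwartzSpace R) <= seminorm k n f + seminorm k n g.
Proof.
apply: seminorm_le => x.
apply: le_trans (lerD (le_seminorm k n f x) (le_seminorm k n g x)).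
rewrite /weighted -mulrDr cderivenD ler_wpM2l ?exprn_ge0//.
exact: complex.le_normcD.
Qed.

Lemma seminorm0 k n : seminorm k n (0 : schwartzSpace R) = 0.
Proof.
have c0 x : cderiven n (0 : schwartzSpace R) x = 0.
  by apply: (@addIr _ (cderiven n (0 : schwartzSpace R) x)); rewrite -cderivenD addr0 add0r.
have w0 x : weighted k n (0 : schwartzSpace R) x = 0.
  by rewrite /weighted c0 [X in _ * X](@ComplexField.Normc.normc0 R) mulr0.
apply/eqP; rewrite eq_le seminorm_le => [|x]; last by rewrite w0.
by rewrite -{1}(w0 0) le_seminorm.
Qed.

Definition seminorm_nbhs f : set_system (schwartzSpace R) :=
  [set A | exists N (e : R), 0 < e /\ forall g,
    (forall k n, (k <= N)%N -> (n <= N)%N ->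
       seminorm k n (g - f : schwartzSpace R) < e) -> A g].

Lemma seminorm_nbhs_filter f : Filter (seminorm_nbhs f).
Proof.
split.
- by exists 0%N, 1.
- move=> A B [N [e [e0 hA]]] [M [d [d0 hB]]].
  exists (maxn N M), (Num.min e d); split; first by rewrite lt_min e0.
  move=> g hg; split; [apply: hA|apply: hB] => k n kN nN;
    by have := hg k n; rewrite lt_min !leq_max kN nN ?orbT => /(_ isT isT)/andP[].
- by move=> A B AB [N [e [e0 hA]]]; exists N, e; split=> // g /hA/AB.
Qed.

Lemma nbhs_schwartzE f : nbhs f = seminorm_nbhs f.
Proof.
have FF := seminorm_nbhs_filter f.
apply/seteqP; split=> A.
  rewrite nbhsE => -[B [[D DB] <-] /=] [C DC Cf] /(subset_trans (bigcup_sup DC)) CA.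
  apply: (@filterS _ (seminorm_nbhs f) FF _ _ CA); have [E hE CE] := DB _ DC.
  rewrite -CE; apply: filter_bigI => i Ei.
  have /set_mem[k [n [h [e [e0 iE]]]]] := hE _ Ei.
  have : C f by [].
  rewrite -CE => /(_ i Ei); rewrite /= iE /= => hf.
  exists (maxn k n), (e - seminorm k n (f - h : schwartzSpace R)).
  split; first by rewrite subr_gt0.
  move=> g /(_ k n (leq_maxl _ _) (leq_maxr _ _)); rewrite ltrBrDr => hg.
  have gh : g - h = (g - f) + (f - h) by rewrite addrA subrK.
  suff: seminorm k n (g - h : schwartzSpace R) < e by [].
  by rewrite gh; apply: le_lt_trans hg; exact: seminormD.
move=> [N [e [e0 hA]]].
have ball k n : nbhs f [set g | seminorm k n (g - f : schwartzSpace R) < e].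
  rewrite nbhsE; exists [set g | seminorm k n (g - f : schwartzSpace R) < e] => //.
  split; last by rewrite /= subrr seminorm0.
  set B := [set _ | _]; exists [set B]; last by rewrite bigcup_set1.
  by move=> _ ->; apply: (finI_from1 _ (i := B)); exists k, n, f, e.
have : \forall g \near f, forall kn : 'I_N.+1 * 'I_N.+1,
    seminorm kn.1 kn.2 (g - f : schwartzSpace R) < e.
  by apply: (@filter_forall _ _ _ (nbhs f)) => kn; exact: ball.
apply: filterS => g hg; apply: hA => k n kN nN.
by have := hg (inord k, inord n); rewrite /= !inordK.
Qed.

End SchwartzTopology.

Section Composition.
Variable R : realType.
Implicit Types (u v : R -> R) (p q : {poly R}).

Lemma rdecrM1 u p q : (1 < size p)%N -> rdecr u ->
  rdecr (fun x => q.[x] * u p.[x]).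
Proof.
move=> hp hu.
have linear_growth : exists2 C : R, 0 <= C & forall x, `|x| <= C * (1 + `|p.[x]|).
  elim/poly_ind: p hp {hu} => [|r c IH]; first by rewrite size_poly0.
  move=> hp; have [hr|hr] := leqP (size r) 1.
    move: hp; rewrite (size1_polyC hr); set a := r`_0; have [->|a0 _] := eqVneq a 0.
      by rewrite polyC0 mul0r add0r ltnNge size_polyC_leq1.
    exists (`|a|^-1 * (1 + `|c|)); first by rewrite mulr_ge0 ?invr_ge0 ?addr_ge0.
    move=> x; rewrite !hornerE -mulrA ler_pdivlMl ?normr_gt0// -normrM.
    rewrite -[X in `|X| <= _](addrK c).
    apply: (le_trans (ler_normB _ _)).
    have := normr_ge0 c; have := normr_ge0 (a * x + c); nra.
  have [C C0 hC] := IH hr.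
  exists (1 + C * (1 + `|c|)); first by rewrite addr_ge0// mulr_ge0// addr_ge0.
  move=> x; rewrite !hornerE; have [x1|x1] := lerP `|x| 1.
    have := normr_ge0 c; have := normr_ge0 (r.[x] * x + c).
    have : 0 <= C * (1 + `|c|) by rewrite mulr_ge0// addr_ge0.
    nra.
  apply: (le_trans (hC x)).
  have rx : `|r.[x]| <= `|r.[x] * x + c| + `|c|.
    have : `|r.[x] * x| <= `|r.[x] * x + c| + `|c|.
      by rewrite -[X in `|X| <= _](addrK c) ler_normB.
    apply: le_trans; rewrite normrM ler_peMr// ltW//.
  apply: (@le_trans _ _ (C * ((1 + `|c|) * (1 + `|r.[x] * x + c|)))).
    apply: ler_wpM2l => //.
    have := normr_ge0 c; have := normr_ge0 (r.[x] * x + c); nra.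
  by rewrite mulrA ler_wpM2r ?addr_ge0// lerDr.
have [C C0 hC] := linear_growth.
have poly_growth r : exists D m, 0 <= D /\ forall x, `|r.[x]| <= D * (1 + `|p.[x]|) ^+ m.
  elim/poly_ind: r => [|r c [D [m [D0 hD]]]].
    by exists 0, 0%N; split=> // x; rewrite horner0 normr0 mul0r.
  exists (D * C + `|c|), m.+1; split; first by rewrite addr_ge0 ?mulr_ge0.
  move=> x; rewrite !hornerE mulrDl; apply: (le_trans (ler_normD _ _)).
  have p1 : 1 <= 1 + `|p.[x]| by rewrite lerDl.
  apply: lerD; last by rewrite ler_peMr// exprn_ege1.
  by rewrite normrM exprSr mulrACA ler_pM.
have weight m : exists M : R, forall y, (1 + `|y|) ^+ m * `|u y| <= M.
  have : rdecr u by [].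
  elim: m u {hu} => [|m IH] u hu.
    by have [M hM] := hu 0%N; exists M => y; have := hM y; rewrite !expr0.
  have [M hM] := IH u hu.
  have [|N hN] := IH (fun y => y * u y).
    move=> k; have [N hN] := hu k.+1; exists N => y.
    by rewrite normrM mulrA -exprSr.
  exists (M + N) => y; apply: le_trans (lerD (hM y) (hN y)).
  by rewrite normrM exprSr; lra.
move=> k; have [D [m [D0 hD]]] := poly_growth ('X^k * q).
have [M hM] := weight m; exists (D * M) => x.
rewrite normrM mulrA -normrX -normrM.
have -> : x ^+ k * q.[x] = ('X^k * q).[x] by rewrite !hornerE.
apply: (@le_trans _ _ (D * ((1 + `|p.[x]|) ^+ m * `|u p.[x]|))).
  by rewrite mulrA ler_wpM2r.
by rewrite ler_wpM2l.
Qed.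

(* The derivatives of [u \o p] lie in the span of the [q * (v \o p)]. *)
Inductive pspan p : (R -> R) -> Prop :=
| pspan1 q u : rschwartz u -> pspan p (fun x => q.[x] * u p.[x])
| pspanD u v : pspan p u -> pspan p v -> pspan p (u + v).

Lemma rschwartz_derive1 u : rschwartz u -> rschwartz (derive1 u).
Proof.
have E n : derive1n n (derive1 u) = derive1n n.+1 u.
  by rewrite /derive1n -iterSr.
by move=> [su du]; split=> n; rewrite E; [exact: su|exact: du].
Qed.

Lemma pspan_derive p u : pspan p u ->
  (forall x, derivable u x 1) /\ pspan p (derive1 u).
Proof.
elim=> {u} [q u hu|u v _ [du pu] _ [dv pv]].
  have isd (x : R) : is_derive x (1 : R) (fun x : R => q.[x] * u p.[x])
      (q^`().[x] * u p.[x] + (q * p^`()).[x] * derive1 u p.[x]).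
    have dq := is_derive_poly q x.
    have dp := is_derive_poly p x.
    have [su _] := hu.
    have du : is_derive p.[x] (1 : R) u (derive1 u p.[x]).
      by rewrite derive1E; apply/derivableP; exact: (su 0%N).
    have dc := is_derive1_comp du dp.
    have := is_deriveM dq dc.
    move/is_derive_eq; apply.
    by rewrite /GRing.scale/= hornerM; ring.
  split; first by move=> x; exact: ex_derive.
  rewrite (_ : derive1 _ = (fun x => q^`().[x] * u p.[x]) +
    (fun x => (q * p^`()).[x] * derive1 u p.[x])).
    by apply: pspanD; apply: pspan1 => //; exact: rschwartz_derive1.
  by apply/funext => x; rewrite derive1E; exact: derive_val.
split; first by move=> x; exact: derivableD.
rewrite (_ : derive1 _ = derive1 u + derive1 v); first exact: pspanD.
by apply/funext => x; rewrite derive1E (deriveD (du x) (dv x)) -!derive1E.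
Qed.

Lemma pspan_rdecr p u : (1 < size p)%N -> pspan p u -> rdecr u.
Proof.
move=> hp; elim=> {u} [q u [_ hu]|u v _ hu _ hv]; last exact: rdecrD.
exact: (@rdecrM1 u p q hp (hu 0%N)).
Qed.

Lemma rschwartz_comp p u : (1 < size p)%N -> rschwartz u ->
  rschwartz (u \o horner p).
Proof.
move=> hp hu.
have H n : pspan p (derive1n n (u \o horner p)).
  elim: n => [|n IH]; last by rewrite derive1nS; exact: (pspan_derive IH).2.
  rewrite derive1n0 (_ : _ \o _ = fun x => (1 : {poly R}).[x] * u p.[x]).
    exact: pspan1.
  by apply/funext => x; rewrite hornerE mul1r.
by split=> n; [exact: (pspan_derive (H n)).1|exact: pspan_rdecr hp (H n)].
Qed.

Lemma schwartz_comp p (f : schwartzSpace R) : (1 < size p)%N ->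
  (f \o horner p) \in schwartz (R := R).
Proof.
move=> hp; have /schwartzP[fR fI] := valP f.
by apply/schwartzP; split; rewrite compA; exact: rschwartz_comp.
Qed.

Definition comp_op p (hp : (1 < size p)%N) (f : schwartzSpace R) :
  schwartzSpace R := SchwartzFun (schwartz_comp f hp).

Lemma comp_op_linear p (hp : (1 < size p)%N) : linear (comp_op hp).
Proof. by move=> c f g; apply/val_inj. Qed.

HB.instance Definition _ p (hp : (1 < size p)%N) :=
  GRing.isLinear.Build R[i] (schwartzSpace R) (schwartzSpace R) _
    (comp_op hp) (comp_op_linear hp).

Lemma nofix_nonconstant p : (forall x, p.[x] <> x) -> (1 < size p)%N.
Proof.
move=> hp; rewrite ltnNge; apply/negP => /size1_polyC pE.
by apply: (hp p`_0); rewrite pE !hornerE coefC.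
Qed.

End Composition.

(* Main.v *)
Require Import Defs.
From HB Require Import structures.
From mathcomp Require Import all_boot all_order all_algebra.
From mathcomp Require Import all_classical all_reals all_analysis.
From mathcomp Require Import complex.
From mathcomp Require Import ring lra.
Set Implicit Arguments.
Unset Strict Implicit.
Unset Printing Implicit Defensive.
Import Order.TTheory GRing.Theory Num.Theory.
Import numFieldNormedType.Exports.
Local Open Scope ring_scope.
Local Open Scope classical_set_scope.

(** Write T for composition with phi and phi_n for the n-th iterate.  A fixed
point free polynomial of even degree has degree at least 2, so that
(1 + |x|)^2 <= C (1 + |phi(x)|), and up to the reflection x -> -x it satisfies
phi(x) > x everywhere.  Two consequences give the two inclusions.

The point 0 is in the spectrum: phi tends to infinity in the same direction at
both ends of the line, hence takes some value twice, at a and b say; then every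
T f takes the same value at a and b, whereas a translated Gaussian does not
([schwartz_separates]), and T is not onto.

A nonzero lambda is not: the only candidate for the inverse of T - lambda is the
Neumann series - sum_n lambda^-(n+1) T^n, and T is quasi-nilpotent in a strong
sense.  On a compact set phi(x) - x is bounded below by a positive constant, so
every orbit leaves it after a bounded number of steps, and outside a large ball
one step of phi multiplies 1 + |x| by any prescribed factor; thus
1 + |phi_n(x)| >= c B^n (1 + |x|) for every B ([iter_superexp]).  The
derivatives of T^n f cost only a geometric factor: by the chain rule, the first
m derivatives of h o phi at x are at most K (1 + |x|)^D times those of h at
phi(x), and for a weight (1 + |x|)^k with k >= D this polynomial factor is
absorbed, since (1 + |x|)^(k+D) <= (1 + |x|)^(2k) <= C^k (1 + |phi(x)|)^k
([jet_le_comp_iter]).  So the norm sup (1 + |x|)^k max_(i <= m) |h^(i)(x)| grows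
under T^n at most like L^n; measuring f with the weight of exponent k + 1
instead gains the factor 1 / (1 + |phi_n(x)|) <= B^-n / c, and choosing B large
against L / |lambda| makes the terms of the series decay like 2^-n in every
seminorm ([jet_le_iter_decay]).  The series may therefore be differentiated term
by term and is continuous in f ([resolvent_seminorm_le]); it inverts T - lambda
by telescoping ([comp_resolvent], [resolvent_comp]). *)

(** * Growth of orbits *)

Section Dynamics.
Variable R : realType.
Implicit Types (x y : R) (f : R -> R) (p q : {poly R}).

Definition wt x : R := 1 + `|x|.

Lemma wt_ge1 x : 1 <= wt x. Proof. by rewrite /wt lerDl. Qed.

Lemma wt_gt0 x : 0 < wt x. Proof. exact: lt_le_trans (wt_ge1 x). Qed.

Lemma wt_ge0 x : 0 <= wt x. Proof. exact: ltW (wt_gt0 x). Qed.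

Lemma wtN x : wt (- x) = wt x. Proof. by rewrite /wt normrN. Qed.

Lemma horner_le_wt q : exists K D, 0 <= K /\ forall x, `|q.[x]| <= K * wt x ^+ D.
Proof.
elim/poly_ind: q => [|r c [K [D [K0 hK]]]].
  by exists 0, 0%N; split=> // x; rewrite horner0 normr0 mul0r.
exists (K + `|c|), D.+1; split; first by rewrite addr_ge0.
move=> x; rewrite !hornerE mulrDl; apply: (le_trans (ler_normD _ _)).
apply: lerD; last by rewrite ler_peMr// exprn_ege1// wt_ge1.
rewrite normrM exprSr mulrA ler_pM//.
by rewrite /wt lerDr.
Qed.

(** The induction follows Horner's scheme: multiplying by x gains one power of
|x|, and the added constant is absorbed once |x| is large. *)
Lemma horner_ge_exp p m : size p = m.+1 ->
  exists C L, 0 < C /\ forall x, L <= `|x| -> `|x| ^+ m <= C * `|p.[x]|.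
Proof.
elim/poly_ind: p m => [|r c IH] m; first by rewrite size_poly0.
rewrite size_MXaddC; case: ifP => [_ //|nz] [<-{m}].
have [r0|r0] := eqVneq r 0.
  rewrite {}r0 eqxx /= in nz *; exists `|c|^-1, 0.
  have c0 : 0 < `|c| by rewrite normr_gt0 nz.
  split=> [|x _]; first by rewrite invr_gt0.
  by rewrite size_poly0 expr0 !hornerE mulVf// gt_eqF.
have sr : size r = (size r).-1.+1 by rewrite prednK// size_poly_gt0.
have [C [L [C0 hC]]] := IH _ sr.
exists (2 * C), (Num.max L (Num.max 1 (2 * C * `|c|))); split; first by rewrite mulr_gt0.
move=> x; rewrite !ge_max => /and3P[Lx x1 cx]; rewrite sr exprSr.
have hr := hC x Lx.
rewrite !hornerE.
have h1 : `|x| ^+ (size r).-1 * `|x| <= C * `|r.[x] * x|.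
  by rewrite normrM mulrA ler_wpM2r.
have h2 : `|r.[x] * x| <= `|r.[x] * x + c| + `|c|.
  by rewrite -[X in `|X| <= _](addrK c) ler_normB.
have h3 : `|x| <= `|x| ^+ (size r).-1 * `|x| by rewrite ler_peMl// exprn_ege1.
have : C * `|r.[x] * x| <= C * (`|r.[x] * x + c| + `|c|) by rewrite ler_wpM2l// ltW.
lra.
Qed.

(** Degree at least 2 enters the dynamics through this bound: up to a constant,
p squares the size of its argument. *)
Lemma wt_sq_le_horner p : (2 < size p)%N ->
  exists2 C, 0 < C & forall x, wt x ^+ 2 <= C * wt p.[x].
Proof.
move=> hp; have sp : size p = (size p).-1.+1 by rewrite prednK// ltnW// ltnW.
have [C [L [C0 hC]]] := horner_ge_exp sp.
pose N := Num.max 1 L; have N1 : 1 <= N by rewrite le_max lexx.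
exists (4 * C + (1 + N) ^+ 2); first by rewrite ltr_pwDl ?mulr_gt0// sqr_ge0.
move=> x; have [xN|Nx] := lerP `|x| N.
  apply: (@le_trans _ _ ((1 + N) ^+ 2)).
    by rewrite lerXn2r ?nnegrE ?wt_ge0// ?lerD2l//; lra.
  rewrite -[leLHS]mulr1 ler_pM ?wt_ge1 ?sqr_ge0// lerDr; lra.
have x1 : 1 <= `|x| by rewrite (le_trans _ (ltW Nx)).
have hx : `|x| ^+ 2 <= C * `|p.[x]|.
  apply: le_trans (hC x _); last by rewrite (le_trans _ (ltW Nx))// le_max lexx orbT.
  by apply: ler_weXn2l => //; rewrite -ltnS -sp.
have : wt x ^+ 2 <= 4 * `|x| ^+ 2.
  have -> : 4 * `|x| ^+ 2 = (2 * `|x|) ^+ 2 by ring.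
  by rewrite lerXn2r ?nnegrE ?wt_ge0 ?mulr_ge0// /wt; lra.
have : 0 <= (1 + N) ^+ 2 * wt p.[x] by rewrite mulr_ge0 ?sqr_ge0 ?wt_ge0.
have : wt p.[x] = 1 + `|p.[x]| by [].
rewrite mulrDl; nra.
Qed.

Lemma uniform_displacement f (L : R) : 0 <= L -> continuous f ->
  (forall x, x < f x) ->
  exists2 d, 0 < d & forall x, `|x| <= L -> x + d <= f x.
Proof.
move=> L0 cf hf.
have cg : {within `[- L, L], continuous (fun x : R => f x - x)}.
  by apply: continuous_subspaceT => x; apply: cvgB; [exact: cf|exact: cvg_id].
have [|c _ hc] := EVT_min _ cg; first by rewrite -subr_ge0 opprK addr_ge0.
exists (f c - c); first by rewrite subr_gt0.
move=> x xL; have := hc x; rewrite in_itv/= -ler_norml => /(_ xL); lra.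
Qed.

(** On the ball of radius L every step moves the point by at least d to the
right, so an orbit can stay there for at most 2 L / d steps. *)
Lemma iter_leaves f (L : R) : 0 <= L -> continuous f -> (forall x, x < f x) ->
  exists n0, forall x, exists2 j, (j <= n0)%N & L <= `|iter j f x|.
Proof.
move=> L0 cf hf; have [d d0 hd] := uniform_displacement L0 cf hf.
pose n0 := (Num.truncn (2 * L / d)).+1.
have hn0 : 2 * L < n0%:R * d.
  by rewrite -ltr_pdivrMr// truncnS_gt.
exists n0 => x; apply: contrapT => hj.
have small j : (j <= n0)%N -> `|iter j f x| < L.
  by move=> jn; rewrite ltNge; apply/negP => h; apply: hj; exists j.
have far j : (j <= n0)%N -> x + j%:R * d <= iter j f x.
  elim: j => [|j IH] jn; first by rewrite mul0r addr0.
  have := IH (ltnW jn); have := hd _ (ltW (small j (ltnW jn))).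
  by rewrite iterS -natr1; lra.
have := far n0 (leqnn _); have := small n0 (leqnn _); have := small 0%N (leq0n _).
rewrite /= !ltr_norml => /andP[? ?] /andP[? ?]; lra.
Qed.

(** Once the orbit has left the ball where wt < max 1 (C B), each step multiplies wt by
at least B, and the bounded number n0 of earlier steps only costs a constant. *)
Lemma iter_superexp_pos f (C B : R) : 0 < C -> 0 < B -> continuous f ->
  (forall x, x < f x) -> (forall x, wt x ^+ 2 <= C * wt (f x)) ->
  exists2 c, 0 < c & forall n x, c * B ^+ n * wt x <= wt (iter n f x).
Proof.
move=> C0 B0 cf hf hC.
wlog B1 : B B0 / 1 <= B.
  move=> /(_ (B + 1)) [||c c0 hc]; [lra|lra|exists c => // n x].
  apply: le_trans (hc n x); rewrite ler_wpM2r ?wt_ge0// ler_wpM2l ?(ltW c0)//.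
  by rewrite lerXn2r ?nnegrE//; lra.
(* Beyond wt x = C * B the quadratic bound gives wt (f x) >= B * wt x. *)
pose L := Num.max 1 (C * B).
have L1 : 1 <= L by rewrite le_max lexx.
have grow x : L <= wt x -> B * wt x <= wt (f x).
  move=> Lx; rewrite -(ler_pM2l C0); apply: le_trans (hC x).
  rewrite mulrA expr2 ler_wpM2r ?wt_ge0//; apply: le_trans Lx.
  by rewrite le_max lexx orbT.
have growN n x : L <= wt x -> B ^+ n * wt x <= wt (iter n f x).
  move=> Lx; elim: n => [|n IH]; first by rewrite mul1r.
  have Ln : L <= wt (iter n f x).
    by apply: le_trans Lx (le_trans _ IH); rewrite ler_peMl ?wt_ge0// exprn_ege1.
  by apply: le_trans (grow _ Ln); rewrite exprS -mulrA ler_wpM2l// ltW.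
have [n0 hn0] := iter_leaves (le_trans ler01 L1) cf hf.
have Bn0 : 0 < B ^+ n0 by rewrite exprn_gt0.
exists ((B ^+ n0 * L)^-1); first by rewrite invr_gt0 mulr_gt0//; lra.
move=> n x; rewrite -mulrA ler_pdivrMl ?mulr_gt0//; last by lra.
have [xL|Lx] := lerP L (wt x).
  apply: (@le_trans _ _ (1 * wt (iter n f x))); first by rewrite mul1r growN.
  rewrite ler_wpM2r ?wt_ge0// -[leLHS]mulr1 ler_pM// exprn_ege1//.
have [j jn Lj] := hn0 x; have {}Lj : L <= wt (iter j f x) by rewrite /wt; lra.
have [nj|nj] := ltnP n j.
  rewrite -[leLHS]mulr1 ler_pM ?wt_ge1 ?mulr_ge0 ?wt_ge0 ?exprn_ge0//; [lra|].
  rewrite ler_pM ?wt_ge0 ?exprn_ge0//; [lra| |exact: ltW].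
  by apply: ler_weXn2l => //; apply: leq_trans (ltnW nj) jn.
have := growN (n - j)%N _ Lj; rewrite -iterD subnK// => hh.
apply: (@le_trans _ _ (B ^+ n0 * L * (B ^+ (n - j) * wt (iter j f x)))); last first.
  by rewrite ler_wpM2l// mulr_ge0 ?(ltW Bn0)//; lra.
have -> : B ^+ n = B ^+ j * B ^+ (n - j) by rewrite -exprD subnKC.
have -> : B ^+ n0 * L * (B ^+ (n - j) * wt (iter j f x)) =
    B ^+ n0 * (B ^+ (n - j) * (L * wt (iter j f x))) by ring.
rewrite -mulrA ler_pM ?mulr_ge0 ?wt_ge0 ?exprn_ge0 ?ler_weXn2l ?(ltW B0)//.
rewrite ler_wpM2l ?exprn_ge0 ?(ltW B0)//; apply: (le_trans (ltW Lx)).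
by rewrite ler_peMr ?wt_ge1//; lra.
Qed.

Lemma iter_conjN f n x : - iter n (fun y => - f (- y)) x = iter n f (- x).
Proof. by elim: n => //= n IH; rewrite opprK IH. Qed.

Lemma fixpoint_between f a b : continuous f -> f a <= a -> b <= f b ->
  exists z, f z = z.
Proof.
move=> cf fa fb.
have cg : continuous (fun x : R => f x - x).
  by move=> x; apply: cvgB; [exact: cf|exact: cvg_id].
have [ab|ba] := lerP a b.
  have [||z _ /eqP] := @IVT _ (fun x => f x - x) a b 0 ab.
  - exact: continuous_subspaceT.
  - by rewrite ge_min le_max !subr_le0 !subr_ge0 fa fb ?orbT.
  - by rewrite subr_eq0 => /eqP; exists z.
have [||z _ /eqP] := @IVT _ (fun x => f x - x) b a 0 (ltW ba).
- exact: continuous_subspaceT.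
- by rewrite ge_min le_max !subr_le0 !subr_ge0 fa fb ?orbT.
- by rewrite subr_eq0 => /eqP; exists z.
Qed.

(** A continuous function without fixed points lies on one side of the
diagonal; conjugation by the reflection x -> -x exchanges the two sides. *)
Lemma nofix_above f : continuous f -> (forall x, f x <> x) ->
  (forall x, x < f x) \/ (forall x, x < - f (- x)).
Proof.
move=> cf nf; have [h0|h0] := ltP 0 (f 0); [left|right] => x;
  rewrite ltNge; apply/negP => fx.
  by have [z /nf] := fixpoint_between cf fx (ltW h0).
have fx' : - x <= f (- x) by rewrite lerNl.
by have [z /nf] := fixpoint_between cf h0 fx'.
Qed.

Lemma continuous_conjN f : continuous f -> continuous (fun x => - f (- x)).
Proof.
move=> cf x; apply: cvgN; apply: (@continuous_comp _ _ _ -%R f); last exact: cf.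
exact: opp_continuous.
Qed.

Lemma iter_superexp f (C B : R) : 0 < C -> 0 < B -> continuous f ->
  (forall x, f x <> x) -> (forall x, wt x ^+ 2 <= C * wt (f x)) ->
  exists2 c, 0 < c & forall n x, c * B ^+ n * wt x <= wt (iter n f x).
Proof.
move=> C0 B0 cf nf hC; have [hf|hf] := nofix_above cf nf.
  exact: iter_superexp_pos hC.
have hN x : wt x ^+ 2 <= C * wt (- f (- x)) by rewrite wtN -(wtN x) hC.
have [c c0 hc] := iter_superexp_pos C0 B0 (continuous_conjN cf) hf hN.
by exists c => // n x; have := hc n (- x); rewrite -[wt (iter _ _ _)]wtN iter_conjN opprK wtN.
Qed.

(** On the far left f lies above the diagonal and is large in absolute value,
so it is large and positive there; a value v above f 0 is then taken on each
side of 0. *)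
Lemma not_injective_pos f (C : R) : 0 < C -> continuous f ->
  (forall x, x < f x) -> (forall x, wt x ^+ 2 <= C * wt (f x)) ->
  exists a b : R, a <> b /\ f a = f b.
Proof.
move=> C0 cf hf hC.
(* v > 2 * C forces |f (- v)| > v. *)
pose v := Num.max (2 * C) (f 0) + 1.
have v0 : 0 < v by have := hf 0; rewrite /v; case: (leP (2 * C) (f 0)); lra.
have fv : f 0 < v by rewrite /v; case: (leP (2 * C) (f 0)); lra.
have vC : 2 * C <= v by rewrite /v; case: (leP (2 * C) (f 0)); lra.
have fNv : v < f (- v).
  have h : 2 * wt v <= wt (f (- v)).
    rewrite -(ler_pM2l C0); apply: le_trans (hC _); rewrite wtN mulrA expr2.
    by rewrite ler_wpM2r ?wt_ge0// /wt gtr0_norm//; lra.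
  have := hf (- v); move: h; rewrite /wt (gtr0_norm v0).
  by case: (ger0P (f (- v))); lra.
have IVTf (c d : R) : c <= d -> Num.min (f c) (f d) <= v <= Num.max (f c) (f d) ->
    exists2 a, a \in `[c, d]%R & f a = v.
  by move=> cd hv; apply: IVT => //; exact: continuous_subspaceT.
have [|a ain fa] := IVTf 0 v (ltW v0).
  by rewrite ge_min le_max (ltW fv) (ltW (hf v)) orbT.
have [||b bin fb] := IVTf (- v) 0; first lra.
  by rewrite ge_min le_max (ltW fv) (ltW fNv) orbT.
exists a, b; rewrite fa fb; split=> // ab; move: ain bin.
rewrite -ab !in_itv/= => /andP[a0 _] /andP[_ a0'].
have a00 : a = 0 by lra.
by move: fa; rewrite a00; lra.
Qed.

Lemma not_injective f (C : R) : 0 < C -> continuous f ->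
  (forall x, f x <> x) -> (forall x, wt x ^+ 2 <= C * wt (f x)) ->
  exists a b : R, a <> b /\ f a = f b.
Proof.
move=> C0 cf nf hC; have [hf|hf] := nofix_above cf nf.
  exact: not_injective_pos hC.
have hN x : wt x ^+ 2 <= C * wt (- f (- x)) by rewrite wtN -(wtN x) hC.
have [a [b [ab fab]]] := not_injective_pos C0 (continuous_conjN cf) hf hN.
by exists (- a), (- b); split=> [/oppr_inj|] //; apply: oppr_inj.
Qed.

End Dynamics.

(** * Derivatives along orbits *)

Section Jets.
Variable R : realType.
Implicit Types (x y t : R) (u v h : R -> R) (p q : {poly R}).

(** Bounding all derivatives up to order m by the same number makes the chain
rule an estimate that can be proved by induction on m without Faa di Bruno's
coefficients. *)
Definition jet_le m u y t := forall i, (i <= m)%N -> `|derive1n i u y| <= t.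

Lemma derive1nSr n u : derive1n n (derive1 u) = derive1n n.+1 u.
Proof. by rewrite /derive1n -iterSr. Qed.

Lemma jet_leS m u y t :
  jet_le m.+1 u y t <-> `|u y| <= t /\ jet_le m (derive1 u) y t.
Proof.
split=> [hu|[h0 hu]]; last by case=> [|i] im //; rewrite -derive1nSr hu.
by split=> [|i im]; [exact: (hu 0%N)|rewrite derive1nSr hu].
Qed.

Lemma jet_leD m u v y s t : rsmooth u -> rsmooth v ->
  jet_le m u y s -> jet_le m v y t -> jet_le m (u + v) y (s + t).
Proof.
move=> su sv hu hv i im; rewrite derive1nD//.
by apply: (le_trans (ler_normD _ _)); rewrite lerD ?hu ?hv.
Qed.

Lemma jet_leW m u y s t : s <= t -> jet_le m u y s -> jet_le m u y t.
Proof. by move=> st hu i /hu /le_trans; apply. Qed.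

Lemma jet_le_ge0 m u y t : jet_le m u y t -> 0 <= t.
Proof. by move=> /(_ 0%N isT); exact: le_trans. Qed.

Lemma pspan_smooth p u : pspan p u -> rsmooth u.
Proof.
move=> pu n; suff /pspan_derive[] : pspan p (derive1n n u) by [].
by elim: n => [//|n IH]; rewrite derive1nS; exact: (pspan_derive IH).2.
Qed.

Lemma derive1_mul_comp p q h : rschwartz h ->
  derive1 (fun x => q.[x] * h p.[x]) =
  (fun x => (deriv q).[x] * h p.[x]) + (fun x => (q * deriv p).[x] * derive1 h p.[x]).
Proof.
move=> [sh _]; apply/funext => y; rewrite derive1E.
have dh : is_derive p.[y] (1 : R) h (derive1 h p.[y]).
  by rewrite derive1E; apply/derivableP; exact: (sh 0%N).
have := is_deriveM (is_derive_poly q y) (is_derive1_comp dh (is_derive_poly p y)).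
move=> H; rewrite (@derive_val _ _ _ _ _ _ _ H) /GRing.scale/= !fctE hornerM; ring.
Qed.

(** Derivatives of q * (h o p) are again sums of such products, with h replaced
by its derivative; the polynomial factor q is therefore part of the induction. *)
Lemma jet_le_mul_comp p m q : exists K D, 0 <= K /\ forall h x t, rschwartz h ->
  jet_le m h p.[x] t -> jet_le m (fun x => q.[x] * h p.[x]) x (K * wt x ^+ D * t).
Proof.
elim: m q => [|m IH] q; have [K0 [D0 [K00 h0]]] := horner_le_wt q.
  exists K0, D0; split=> // h x t _ ht [|//] _.
  by rewrite derive1n0 normrM ler_pM//; exact: (ht 0%N).
have [K1 [D1 [K10 h1]]] := IH (deriv q).
have [K2 [D2 [K20 h2]]] := IH (q * deriv p).
exists (K0 + (K1 + K2)), (D0 + (D1 + D2))%N; split; first by rewrite !addr_ge0.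
move=> h x t sh ht; have t0 := jet_le_ge0 ht.
have le_exp a D : 0 <= a -> (D <= D0 + (D1 + D2))%N ->
    a * wt x ^+ D * t <= a * wt x ^+ (D0 + (D1 + D2)) * t.
  by move=> a0 hD; rewrite ler_wpM2r// ler_wpM2l// ler_weXn2l// wt_ge1.
have e0 := le_exp _ D0 K00 (leq_addr _ _).
have e1 := le_exp _ D1 K10 (leq_trans (leq_addr _ _) (leq_addl _ _)).
have e2 := le_exp _ D2 K20 (leq_trans (leq_addl _ _) (leq_addl _ _)).
have r0 a : 0 <= a -> 0 <= a * wt x ^+ (D0 + (D1 + D2)) * t.
  by move=> a0; rewrite !mulr_ge0 ?exprn_ge0 ?wt_ge0.
have := r0 _ K00; have := r0 _ K10; have := r0 _ K20 => r2 r1 r00.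
move: (ht) => /jet_leS[hh hh']; apply/jet_leS; split.
  apply: (@le_trans _ _ (K0 * wt x ^+ D0 * t)); last by rewrite mulrDl mulrDl; lra.
  by rewrite normrM ler_pM.
rewrite derive1_mul_comp//.
have hd1 : jet_le m h p.[x] t by move=> i im; exact/ht/leqW.
apply: jet_leW (jet_leD _ _ (h1 h x t sh hd1)
  (h2 _ x t (rschwartz_derive1 sh) hh')).
- by rewrite !mulrDl; lra.
- by apply: (@pspan_smooth p); exact: pspan1.
- by apply: (@pspan_smooth p); apply: pspan1; exact: rschwartz_derive1.
Qed.

Lemma rschwartz_comp_iter p n h : (1 < size p)%N -> rschwartz h ->
  rschwartz (h \o iter n (horner p)).
Proof.
move=> hp sh; elim: n => [//|n IH].
rewrite (_ : _ \o _ = (h \o iter n (horner p)) \o horner p).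
  exact: rschwartz_comp.
by apply/funext => x; rewrite /= -iterS iterSr.
Qed.

(** With a weight exponent k at least the degree D of the chain rule factor, one
step loses nothing in the weight, because wt x ^ (2 k) <= C ^ k * wt p.[x] ^ k.
The constant L depends on k and m but not on n. *)
Lemma jet_le_comp_iter p m : (2 < size p)%N ->
  exists k0, forall k, (k0 <= k)%N -> exists2 L, 0 < L &
  forall n h x t, rschwartz h ->
  jet_le m h (iter n (horner p) x) (t / wt (iter n (horner p) x) ^+ k) ->
  jet_le m (h \o iter n (horner p)) x (L ^+ n * (t / wt x ^+ k)).
Proof.
move=> hp; have [C C0 hC] := wt_sq_le_horner hp.
have [K [D [K0 hK]]] := jet_le_mul_comp p m 1.
exists D => k Dk; exists ((K + 1) * C ^+ k).
  by rewrite mulr_gt0 ?exprn_gt0//; lra.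
have step h x t : rschwartz h -> jet_le m h p.[x] (t / wt p.[x] ^+ k) ->
    jet_le m (h \o horner p) x ((K + 1) * C ^+ k * (t / wt x ^+ k)).
  move=> sh hh.
  have t0 : 0 <= t.
    by have := jet_le_ge0 hh; rewrite pmulr_lge0// invr_gt0 exprn_gt0// wt_gt0.
  have := hK h x _ sh hh.
  rewrite (_ : (fun x => _) = h \o horner p); last first.
    by apply/funext => y; rewrite hornerE mul1r.
  apply: jet_leW.
  have h1 : wt x ^+ D <= wt x ^+ k by rewrite ler_weXn2l// wt_ge1.
  have h2 : wt x ^+ k * wt x ^+ k <= C ^+ k * wt p.[x] ^+ k.
    by rewrite -!exprMn -expr2 lerXn2r ?nnegrE ?sqr_ge0 ?mulr_ge0 ?wt_ge0// ltW.
  have w0 y : 0 < wt y ^+ k by rewrite exprn_gt0// wt_gt0.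
  rewrite !mulrA ler_pdivlMr// mulrAC ler_pdivrMr//.
  have -> : K * wt x ^+ D * t * wt x ^+ k = (K * t) * (wt x ^+ D * wt x ^+ k) by ring.
  have -> : (K + 1) * C ^+ k * t * wt p.[x] ^+ k =
    ((K + 1) * t) * (C ^+ k * wt p.[x] ^+ k) by ring.
  apply: ler_pM; rewrite ?mulr_ge0 ?exprn_ge0 ?wt_ge0//.
    by rewrite ler_wpM2r//; lra.
  by apply: le_trans h2; rewrite ler_wpM2r// ltW.
elim=> [|n IH] h x t sh hh; first by rewrite mul1r; exact: hh.
rewrite (_ : _ \o _ = (h \o iter n (horner p)) \o horner p); last first.
  by apply/funext => y; rewrite /= -iterS iterSr.
rewrite exprS -mulrA; set L := _ * C ^+ k in IH step *.
rewrite [X in L * X]mulrA; apply: step; first exact: (rschwartz_comp_iter _ (ltnW hp)).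
by rewrite -mulrA; apply: IH => //; rewrite -iterSr.
Qed.

(** The extra power of the weight in the hypothesis turns the superexponential
growth of the orbit into a decay that beats both L^n and r^n. *)
Lemma jet_le_iter_decay p k m (r : R) : (2 < size p)%N ->
  (forall x, p.[x] <> x) -> 0 <= r ->
  exists k' C, 0 <= C /\ forall h M, rschwartz h ->
  (forall y, jet_le m h y (M / wt y ^+ k')) -> forall n x i, (i <= m)%N ->
  r ^+ n * `|derive1n i (h \o iter n (horner p)) x| <= C * M / wt x ^+ k * 2^-1 ^+ n.
Proof.
move=> hp nf r0; have [k0 hk0] := jet_le_comp_iter m hp.
pose kk := maxn k k0; have [L L0 hL] := hk0 kk (leq_maxr _ _).
have [C C0 hC] := wt_sq_le_horner hp.
(* The factor 2 leaves the ratio r * L / B below 1/2. *)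
pose B := 2 * (r * L) + 1.
have rL0 : 0 <= r * L by rewrite mulr_ge0// ltW.
have B0 : 0 < B by rewrite /B; lra.
have [c c0 hc] := iter_superexp C0 B0 (@continuous_horner _ p) nf hC.
exists kk.+1, c^-1; split; first by rewrite invr_ge0 ltW.
move=> h M sh hM n x i im.
have M0 : 0 <= M.
  have := jet_le_ge0 (hM x); rewrite pmulr_lge0// invr_gt0 exprn_gt0// wt_gt0//.
have := hM (iter n (horner p) x); set y := iter n _ x.
have -> : M / wt y ^+ kk.+1 = M / wt y / wt y ^+ kk by rewrite exprS invfM mulrA.
move=> /(hL n h x _ sh) /(_ i im) hi.
apply: (le_trans (ler_wpM2l (exprn_ge0 n r0) hi)).
have wy : c * B ^+ n <= wt y.
  apply: le_trans (hc n x).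
  by rewrite ler_peMr ?wt_ge1// mulr_ge0 ?exprn_ge0 ?(ltW c0) ?(ltW B0).
have hwy : M / wt y <= c^-1 * M / B ^+ n.
  rewrite -mulrA mulrCA ler_wpM2l// -invfM lef_pV2 ?posrE ?wt_gt0//.
  by rewrite mulr_gt0 ?exprn_gt0.
have hrL : r ^+ n * L ^+ n <= B ^+ n * 2^-1 ^+ n.
  by rewrite -!exprMn lerXn2r ?nnegrE ?mulr_ge0//; rewrite /B; lra.
have hw : (wt x ^+ kk)^-1 <= (wt x ^+ k)^-1.
  by rewrite lef_pV2 ?posrE ?exprn_gt0 ?wt_gt0// ler_weXn2l ?wt_ge1 ?leq_maxl.
have iw j : 0 <= (wt x ^+ j)^-1 by rewrite invr_ge0 exprn_ge0 ?wt_ge0.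
have My : 0 <= M / wt y by rewrite divr_ge0 ?wt_ge0.
rewrite mulrA.
apply: (@le_trans _ _ ((B ^+ n * 2^-1 ^+ n) * ((c^-1 * M / B ^+ n) / wt x ^+ k))).
  apply: ler_pM; [|exact: mulr_ge0|exact: hrL|exact: ler_pM].
  by rewrite mulr_ge0 ?exprn_ge0// ltW.
have Bn : B ^+ n != 0 by rewrite expf_neq0// gt_eqF.
have wn : wt x ^+ k != 0 by rewrite expf_neq0// gt_eqF// wt_gt0.
by rewrite le_eqVlt; apply/orP; left; apply/eqP; field; rewrite Bn wn gt_eqF.
Qed.

End Jets.

(** * Termwise differentiation of series *)

Section Series.
Variable R : realType.
Implicit Types (x y : R) (u : R -> R) (a b : nat -> R).

Lemma geo_is_cvg a (M : R) : (forall n, `|a n| <= M * 2^-1 ^+ n) ->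
  cvgn [normed series a] /\ cvgn (series a).
Proof.
move=> ha; have M0 : 0 <= M by have := ha 0%N; rewrite mulr1; exact: le_trans.
have h : cvgn [normed series a].
  apply: (@series_le_cvg _ (fun n => `|a n|) (geometric M 2^-1)) => //.
  - by move=> n; rewrite /= mulr_ge0// exprn_ge0.
  - by apply: is_cvg_geometric_series; rewrite ger0_norm// invf_lt1// ltr1n.
by split=> //; exact: normed_cvg.
Qed.

Lemma geo_lim_le a (M : R) : (forall n, `|a n| <= M * 2^-1 ^+ n) ->
  `|limn (series a)| <= M * 2.
Proof.
move=> ha; have [nc c] := geo_is_cvg ha.
apply: (le_trans (lim_series_norm nc)).
have z1 : `|2^-1 : R| < 1 by rewrite ger0_norm// invf_lt1// ltr1n.
have e : limn (series (geometric M 2^-1)) = M * 2.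
  rewrite (cvg_lim _ (cvg_geometric_series z1))//; congr (_ * _).
  by rewrite (_ : 1 - 2^-1 = 2^-1) ?invrK//; lra.
by rewrite -e; apply: lim_series_le => //; exact: is_cvg_geometric_series.
Qed.

(** The mean value theorem without an assumption on the order of x and y. *)
Lemma mean_value u x y : (forall z, derivable u z 1) ->
  exists2 c, `|c - x| <= `|y - x| & u y - u x = derive1 u c * (y - x).
Proof.
move=> du.
have D z : is_derive z (1 : R) u (derive1 u z) by rewrite derive1E; exact: derivableP.
have cu (A : set R) : {within A, continuous u}.
  by apply: continuous_subspaceT => z; apply: differentiable_continuous; exact/derivable1_diffP.
have [xy|yx] := lerP x y.
  have [c] := MVT_segment xy (fun z _ => D z) (cu _).
  rewrite in_itv/= => /andP[xc cy] e; exists c => //.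
  by rewrite !ger0_norm ?subr_ge0// lerB.
have [c] := MVT_segment (ltW yx) (fun z _ => D z) (cu _).
rewrite in_itv/= => /andP[yc cx] e; exists c.
  by rewrite !ler0_norm ?subr_le0 ?(ltW yx)//; lra.
by rewrite -opprB e; ring.
Qed.

(** Uniform control of difference quotients; this replaces uniform convergence
in the termwise differentiation below. *)
Lemma taylor1_le u (M : R) x h : (forall z, derivable u z 1) ->
  (forall z, derivable (derive1 u) z 1) ->
  (forall z, `|derive1 (derive1 u) z| <= M) -> h != 0 ->
  `|h^-1 * (u (h + x) - u x) - derive1 u x| <= M * `|h|.
Proof.
move=> du ddu hM h0.
have [c cx ->] := mean_value x (h + x) du.
have [d _ e] := mean_value x c ddu.
rewrite addrK mulrCA mulVf// mulr1 e normrM ler_pM//.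
by rewrite addrK in cx.
Qed.

(** Summing [taylor1_le] over n bounds the error of the difference quotient of
the sum by a constant multiple of |h|. *)
Lemma is_derive_series (v : nat -> R -> R) (M0 M1 M2 : R) x :
  (forall n z, derivable (v n) z 1) ->
  (forall n z, derivable (derive1 (v n)) z 1) ->
  (forall n z, `|v n z| <= M0 * 2^-1 ^+ n) ->
  (forall n z, `|derive1 (v n) z| <= M1 * 2^-1 ^+ n) ->
  (forall n z, `|derive1 (derive1 (v n)) z| <= M2 * 2^-1 ^+ n) ->
  is_derive x (1 : R) (fun z => limn (series (v^~ z)))
    (limn (series (fun n => derive1 (v n) x))).
Proof.
move=> d0 d1 h0 h1 h2; set F := fun z => _; set G := limn _.
have M20 : 0 <= M2 by have := h2 0%N 0; rewrite mulr1; exact: le_trans.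
have bound h : h != 0 -> `|h^-1 *: ((F \o shift x) (h *: (1 : R)) - F x) - G| <= M2 * 2 * `|h|.
  move=> hn.
  have [_ c1] := geo_is_cvg (h0^~ (h + x)); have [_ c2] := geo_is_cvg (h0^~ x).
  have [_ c3] := geo_is_cvg (h1^~ x).
  have -> : h^-1 *: ((F \o shift x) (h *: (1 : R)) - F x) - G =
     limn (series (h^-1 *: ((v^~ (h + x)) - (v^~ x)) - (fun n => derive1 (v n) x))).
    have c12 := is_cvg_seriesB c1 c2.
    rewrite (lim_seriesB (is_cvg_seriesZ (k := h^-1) c12) c3) (lim_seriesZ h^-1 c12).
    rewrite (lim_seriesB c1 c2) /F /G /= /shift/= [h *: 1]mulr1//.
  have -> : M2 * 2 * `|h| = (M2 * `|h|) * 2 by ring.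
  apply: geo_lim_le => n; rewrite mulrAC.
  have := taylor1_le x (d0 n) (d1 n) (h2 n) hn.
  by rewrite !fctE.
have lim : h^-1 *: ((F \o shift x) (h *: (1 : R)) - F x) @[h --> 0^'] --> G.
  have K0 : 0 < M2 * 2 + 1 by lra.
  apply/cvgrPdist_le => e e0; near=> h.
  have hn : h != 0 by near: h; exact: nbhs_dnbhs_neq.
  rewrite distrC; apply: le_trans (bound h hn) _.
  have : `|h| <= e / (M2 * 2 + 1).
    by near: h; apply: dnbhs0_le; rewrite divr_gt0.
  rewrite ler_pdivlMr// => hh; apply: le_trans hh.
  by rewrite mulrC ler_wpM2l//; lra.
split; first exact: (cvgP _ lim).
exact: (cvg_lim _ lim).
Unshelve. all: by end_near. Qed.

Lemma series_smooth (v : nat -> R -> R) (M : nat -> R) :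
  (forall n, rsmooth (v n)) ->
  (forall m n z, `|derive1n m (v n) z| <= M m * 2^-1 ^+ n) ->
  rsmooth (fun z => limn (series (v^~ z))) /\
  forall m, derive1n m (fun z => limn (series (v^~ z))) =
    (fun z => limn (series (fun n => derive1n m (v n) z))).
Proof.
move=> sv hM.
have D m x : is_derive x (1 : R) (fun z => limn (series (fun n => derive1n m (v n) z)))
    (limn (series (fun n => derive1n m.+1 (v n) x))).
  apply: (@is_derive_series (fun n => derive1n m (v n)) (M m) (M m.+1) (M m.+2)).
  - by move=> n; exact: sv.
  - by move=> n; exact: (sv n m.+1).
  - exact: hM.
  - exact: (hM m.+1).
  - exact: (hM m.+2).
have E m : derive1n m (fun z => limn (series (v^~ z))) =
    (fun z => limn (series (fun n => derive1n m (v n) z))).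
  elim: m => [//|m IH]; rewrite derive1nS IH; apply/funext => x.
  by rewrite derive1E; exact: (@derive_val _ _ _ _ _ _ _ (D m x)).
by split=> // m x; rewrite E; exact: (@ex_derive _ _ _ _ _ _ _ (D m x)).
Qed.

End Series.

(** * Series along an orbit *)

Section Estimates.
Variable R : realType.
Implicit Types (x y : R) (u v : R -> R) (c : nat -> R) (p : {poly R}).

Lemma wt_exp_le k x : wt x ^+ k <= 2 ^+ k * (1 + `|x| ^+ k).
Proof.
have [x1|x1] := lerP `|x| 1.
  apply: (@le_trans _ _ (2 ^+ k)); last by rewrite ler_peMr ?exprn_ge0// lerDl exprn_ge0.
  by rewrite lerXn2r ?nnegrE ?wt_ge0// /wt; lra.
apply: (@le_trans _ _ ((2 * `|x|) ^+ k)).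
  by rewrite lerXn2r ?nnegrE ?wt_ge0 ?mulr_ge0// /wt; lra.
by rewrite exprMn ler_wpM2l ?exprn_ge0// lerDr.
Qed.

(** Converts bounds on the usual Schwartz seminorms into the form used for the
dynamical estimates. *)
Lemma jet_le_weights k m u (M : R) :
  (forall i j y, (i <= k)%N -> (j <= m)%N -> `|y| ^+ i * `|derive1n j u y| <= M) ->
  forall y, jet_le m u y (2 ^+ k * (2 * M) / wt y ^+ k).
Proof.
move=> hM y j jm; rewrite ler_pdivlMr ?exprn_gt0 ?wt_gt0// mulrC.
apply: (le_trans (ler_wpM2r _ (wt_exp_le k y))) => //.
rewrite -mulrA ler_wpM2l ?exprn_ge0// mulrDl mulr2n mulrDl.
have := hM 0%N j y (leq0n _) jm; have := hM k j y (leqnn _) jm.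
by rewrite expr0; lra.
Qed.

Lemma jet_leWk m u y (M : R) k k' : (k' <= k)%N ->
  jet_le m u y (M / wt y ^+ k) -> jet_le m u y (M / wt y ^+ k').
Proof.
move=> kk hu; have w0 j : 0 < wt y ^+ j by rewrite exprn_gt0// wt_gt0.
have M0 : 0 <= M by have := jet_le_ge0 hu; rewrite pmulr_lge0// invr_gt0.
apply: jet_leW hu; rewrite ler_wpM2l// lef_pV2 ?posrE//.
by rewrite ler_weXn2l// wt_ge1.
Qed.

Lemma rschwartz_jet k m u : rschwartz u ->
  exists M, forall y, jet_le m u y (M / wt y ^+ k).
Proof.
have base v : rschwartz v -> exists M, forall y, `|v y| <= M / wt y ^+ k.
  move=> [_ dv]; have [M0 h0] := dv 0%N 0%N; have [M1 h1] := dv 0%N k.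
  exists (2 ^+ k * (M0 + M1)) => y.
  rewrite ler_pdivlMr ?exprn_gt0 ?wt_gt0// mulrC.
  apply: (le_trans (ler_wpM2r _ (wt_exp_le k y))) => //.
  rewrite -mulrA ler_wpM2l ?exprn_ge0// mulrDl.
  by have := h0 y; have := h1 y; rewrite expr0 derive1n0; lra.
elim: m u => [|m IH] u su; have [M0 h0] := base u su.
  by exists M0 => y [|//] _; exact: h0.
have [M1 h1] := IH _ (rschwartz_derive1 su).
exists (M0 + M1) => y; have iw : 0 < (wt y ^+ k)^-1 by rewrite invr_gt0 exprn_gt0// wt_gt0.
have M00 : 0 <= M0 / wt y ^+ k by exact: le_trans (h0 y).
have M10 : 0 <= M1 / wt y ^+ k by exact: jet_le_ge0 (h1 y).
apply/jet_leS; rewrite mulrDl; split; first by apply: (le_trans (h0 y)); lra.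
by apply: jet_leW (h1 y); lra.
Qed.

Definition iter_series p c u : R -> R :=
  fun x => limn (series (fun n => c n * u (iter n (horner p) x))).

Section WithPoly.
Variables (p : {poly R}) (hp : (2 < size p)%N) (nf : forall x, p.[x] <> x).
Variables (A r : R) (A0 : 0 <= A) (r0 : 0 <= r).

Let E := iter_series p.
Let slow c := forall n, `|c n| <= A * r ^+ n.

Lemma iter_series_term c u n : rschwartz u -> forall m,
  derive1n m (fun x => c n * u (iter n (horner p) x)) =
  (fun x => c n * derive1n m (u \o iter n (horner p)) x).
Proof.
move=> su m; have [s _] := rschwartz_comp_iter n (ltnW hp) su.
exact: (derive1nZ (c n) m s).
Qed.

Lemma iter_series_term_le k m : exists k' C, 0 <= C /\ forall c u M, slow c ->
  rschwartz u -> (forall y, jet_le m u y (M / wt y ^+ k')) ->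
  forall n x i, (i <= m)%N ->
  `|c n * derive1n i (u \o iter n (horner p)) x| <= C * M / wt x ^+ k * 2^-1 ^+ n.
Proof.
have [k' [C [C0 hC]]] := jet_le_iter_decay k m hp nf r0.
exists k', (A * C); split; first exact: mulr_ge0.
move=> c u M sc su hu n x i im; rewrite normrM -!mulrA.
apply: (@le_trans _ _ (A * (r ^+ n * `|derive1n i (u \o iter n (horner p)) x|))).
  by rewrite mulrA ler_wpM2r.
by rewrite ler_wpM2l// !mulrA; exact: hC.
Qed.

Lemma iter_series_cvg c u x : slow c -> rschwartz u ->
  cvgn (series (fun n => c n * u (iter n (horner p) x))).
Proof.
move=> sc su; have [k' [C [C0 hC]]] := iter_series_term_le 0 0.
have [M hM] := rschwartz_jet k' 0 su.
exact: (geo_is_cvg (fun n => hC c u M sc su hM n x 0%N isT)).2.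
Qed.

Lemma iter_series_smooth c u : slow c -> rschwartz u -> rsmooth (E c u) /\
  forall m, derive1n m (E c u) = (fun x => limn (series (fun n =>
    c n * derive1n m (u \o iter n (horner p)) x))).
Proof.
move=> sc su.
have B m : exists M, forall n x,
    `|c n * derive1n m (u \o iter n (horner p)) x| <= M * 2^-1 ^+ n.
  have [k' [C [C0 hC]]] := iter_series_term_le 0 m.
  have [M hM] := rschwartz_jet k' m su.
  by exists (C * M / 1) => n x; rewrite -(expr0 (wt x)); exact: hC.
have /choice[M hM] := B.
have [||s d] := @series_smooth _ (fun n x => c n * u (iter n (horner p) x)) M.
- move=> n m x; rewrite iter_series_term//.
  have [s _] := rschwartz_comp_iter n (ltnW hp) su.
  exact: derivableZ.
- by move=> m n x; rewrite iter_series_term.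
split=> // m; rewrite d; apply/funext => x; congr (limn (series _)).
by apply/funext => n; rewrite iter_series_term.
Qed.

Lemma iter_series_jet k m : exists k' C, 0 <= C /\ forall c u M, slow c ->
  rschwartz u -> (forall y, jet_le m u y (M / wt y ^+ k')) ->
  forall x, jet_le m (E c u) x (C * M / wt x ^+ k).
Proof.
have [k' [C [C0 hC]]] := iter_series_term_le k m.
exists k', (C * 2); split; first by rewrite mulr_ge0.
move=> c u M sc su hu x i im; rewrite (iter_series_smooth sc su).2.
have -> : C * 2 * M / wt x ^+ k = C * M / wt x ^+ k * 2 by ring.
by apply: geo_lim_le => n; exact: hC.
Qed.

Lemma iter_series_rschwartz c u : slow c -> rschwartz u -> rschwartz (E c u).
Proof.
move=> sc su; split; first exact: (iter_series_smooth sc su).1.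
move=> m k; have [k' [C [C0 hC]]] := iter_series_jet k m.
have [M hM] := rschwartz_jet k' m su.
exists (C * M) => x; have := hC c u M sc su hM x m (leqnn m).
rewrite ler_pdivlMr ?exprn_gt0 ?wt_gt0// mulrC; apply: le_trans.
by rewrite ler_wpM2r// lerXn2r ?nnegrE ?wt_ge0// /wt lerDr.
Qed.

(** The argument is the real part of (T - lambda) f for f = u + i v and
lambda = l + i m; the imaginary part is the instance with u and v exchanged and
- m for m. *)
Lemma iter_series_lin c u v (l m : R) x : slow c -> rschwartz u -> rschwartz v ->
  E c (fun y => u p.[y] - (l * u y - m * v y)) x =
  E c u p.[x] - (l * E c u x - m * E c v x).
Proof.
move=> sc su sv; have cu y := iter_series_cvg (x := y) sc su.
have cv := iter_series_cvg (x := x) sc sv.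
have c1 := is_cvg_seriesB (is_cvg_seriesZ (k := l) (cu x)) (is_cvg_seriesZ (k := m) cv).
rewrite /E /iter_series -[l * _](lim_seriesZ l (cu x)) -[m * _](lim_seriesZ m cv).
rewrite -(lim_seriesB (is_cvg_seriesZ (k := l) (cu x)) (is_cvg_seriesZ (k := m) cv)).
rewrite -(lim_seriesB (cu p.[x]) c1).
congr (limn (series _)); apply/funext => n; rewrite !fctE /GRing.scale/=.
by rewrite -iterS iterSr; ring.
Qed.

Lemma cvg_series_shift (a : nat -> R) : cvgn (series a) ->
  series (fun n => a n.+1) @ \oo --> limn (series a) - a 0%N.
Proof.
move=> ca; rewrite (_ : series _ = fun n => series a n.+1 - a 0%N); last first.
  by apply/funext => n; rewrite /series /= big_nat_recl//= addrC addKr.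
by apply: cvgB; [rewrite (cvg_shiftS (series a))|exact: cvg_cst].
Qed.

(** Telescoping: evaluating at p.[x] shifts the orbit by one step, and the
coefficients satisfy a two-term recurrence, the real form of
gamma_n = lambda * gamma_(n+1). *)
Lemma iter_series_shift a b u (l m : R) x : slow a -> slow b -> rschwartz u ->
  forall c, (forall n, c n = l * a n.+1 + m * b n.+1) ->
  E c u p.[x] = l * (E a u x - a 0%N * u x) + m * (E b u x - b 0%N * u x).
Proof.
move=> sa sb su c hc.
have ea := cvg_series_shift (iter_series_cvg (x := x) sa su).
have eb := cvg_series_shift (iter_series_cvg (x := x) sb su).
have ca := cvgP _ ea; have cb := cvgP _ eb.
rewrite /E /iter_series -(cvg_lim _ ea)// -(cvg_lim _ eb)//.
rewrite -[l * _](lim_seriesZ l ca) -[m * _](lim_seriesZ m cb).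
rewrite -(lim_seriesD (is_cvg_seriesZ (k := l) ca) (is_cvg_seriesZ (k := m) cb)).
congr (limn (series _)); apply/funext => n; rewrite !fctE /GRing.scale/=.
by rewrite hc -iterS iterSr; ring.
Qed.

End WithPoly.
End Estimates.

(** * The inverse for a nonzero parameter *)

Section Resolvent.
Variable R : realType.
Implicit Types (z : R[i]) (w : R -> R) (f g : schwartzSpace R).

(** A norm on the complex numbers that separates real and imaginary parts, since
the series is treated componentwise. *)
Definition cnorm1 z : R := `|complex.Re z| + `|complex.Im z|.

Lemma cnorm1M z z' : cnorm1 (z * z') <= cnorm1 z * cnorm1 z'.
Proof.
case: z z' => [a b] [c d]; rewrite /cnorm1 /=.
have h1 := ler_normB (a * c) (b * d); have h2 := ler_normD (a * d) (b * c).
by rewrite !normrM in h1 h2; lra.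
Qed.

Lemma normc_le_cnorm1 z : ComplexField.Normc.normc z <= cnorm1 z.
Proof.
case: z => a b; rewrite /cnorm1 /= -[leRHS]ger0_norm ?addr_ge0//.
rewrite -sqrtr_sqr ler_wsqrtr// sqrrD !real_normK ?num_real//.
by rewrite lerD2r lerDl mulrn_wge0 ?mulr_ge0.
Qed.

Lemma Re_le_normc z : `|complex.Re z| <= ComplexField.Normc.normc z.
Proof. by case: z => a b /=; rewrite -sqrtr_sqr ler_wsqrtr// lerDl sqr_ge0. Qed.

Lemma Im_le_normc z : `|complex.Im z| <= ComplexField.Normc.normc z.
Proof. by case: z => a b /=; rewrite -sqrtr_sqr ler_wsqrtr// lerDr sqr_ge0. Qed.

Variables (p : {poly R}) (hp1 : (1 < size p)%N) (hp : (2 < size p)%N).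
Variables (nf : forall x, p.[x] <> x) (lam : R[i]) (lam0 : lam != 0).

Let u f : R -> R := @complex.Re R \o f.
Let v f : R -> R := @complex.Im R \o f.
Let coef n : R[i] := - lam^-1 ^+ n.+1.
Let a n := complex.Re (coef n).
Let b n := complex.Im (coef n).
Let r := cnorm1 lam^-1.
Let E := iter_series p.

Let r0 : 0 <= r. Proof. by rewrite /r /cnorm1 addr_ge0. Qed.

Let coef_le n : cnorm1 (coef n) <= r * r ^+ n.
Proof.
rewrite -exprS; elim: n => [|n IH].
  by rewrite /coef !expr1 /r; case: (lam^-1) => ? ?; rewrite /cnorm1 /= !normrN.
have -> : coef n.+1 = lam^-1 * coef n by rewrite /coef mulrN -exprS.
by apply: (le_trans (cnorm1M _ _)); rewrite [leRHS]exprS ler_wpM2l.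
Qed.

Let slow_a n : `|a n| <= r * r ^+ n.
Proof. by apply: le_trans (coef_le n); rewrite lerDl. Qed.

Let slow_b n : `|b n| <= r * r ^+ n.
Proof. by apply: le_trans (coef_le n); rewrite lerDr. Qed.

Let coefS n : coef n = lam * coef n.+1.
Proof. by rewrite /coef mulrN [in RHS]exprS mulrA divff// mul1r. Qed.

Let l := complex.Re lam.
Let m := complex.Im lam.

Let aS n : a n = l * a n.+1 + - m * b n.+1.
Proof. by rewrite /a /b coefS /l /m; case: (lam) (coef n.+1) => ? ? [? ?] /=; rewrite mulNr. Qed.

Let bS n : b n = m * a n.+1 + l * b n.+1.
Proof. by rewrite /a /b coefS /l /m; case: (lam) (coef n.+1) => ? ? [? ?] /=; rewrite addrC. Qed.

Let ab0 : l * a 0%N - m * b 0%N = -1 /\ l * b 0%N + m * a 0%N = 0.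
Proof.
have : lam * coef 0%N = -1 by rewrite /coef expr1 mulrN divff.
rewrite /a /b /l /m; case: (lam) (coef 0%N) => ? ? [? ?] /= -[-> ->].
by rewrite oppr0.
Qed.

Let su f : rschwartz (u f). Proof. by have /schwartzP[] := valP f. Qed.
Let sv f : rschwartz (v f). Proof. by have /schwartzP[] := valP f. Qed.

(** The Neumann series - sum_n lambda^-(n+1) f o phi_n, split into its real and
imaginary parts. *)
Definition resolvent_fun f (x : R) : R[i] :=
  Complex (E a (u f) x - E b (v f) x) (E a (v f) x + E b (u f) x).

Let Er c w : (forall n, `|c n| <= r * r ^+ n) -> rschwartz w -> rschwartz (E c w).
Proof. exact: (iter_series_rschwartz hp nf r0 r0). Qed.

Let ReE f : @complex.Re R \o resolvent_fun f = E a (u f) + (-1) *: E b (v f).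
Proof. by apply/funext => x; rewrite /= !fctE scaleN1r. Qed.

Let ImE f : @complex.Im R \o resolvent_fun f = E a (v f) + E b (u f).
Proof. by []. Qed.

Lemma resolvent_schwartz f : resolvent_fun f \in schwartz (R := R).
Proof.
apply/schwartzP; rewrite ReE ImE; split; apply: rschwartzD.
- exact: Er.
- by apply: rschwartzZ; exact: Er.
- exact: Er.
- exact: Er.
Qed.

Definition resolvent f : schwartzSpace R := SchwartzFun (resolvent_schwartz f).

Let shift_a w x : rschwartz w -> E a w p.[x] = l * E a w x - m * E b w x + w x.
Proof.
move=> sw; rewrite /E (iter_series_shift hp nf r0 r0 _ slow_a slow_b sw aS).
have [h _] := ab0; apply/eqP; rewrite -/E -subr_eq0; apply/eqP.
transitivity (- (l * a 0%N - m * b 0%N) * w x - w x); first ring.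
by rewrite h opprK mul1r subrr.
Qed.

Let shift_b w x : rschwartz w -> E b w p.[x] = l * E b w x + m * E a w x.
Proof.
move=> sw; rewrite /E (iter_series_shift hp nf r0 r0 _ slow_a slow_b sw bS) -/E.
have [_ h] := ab0; apply/eqP; rewrite -subr_eq0; apply/eqP.
transitivity (- (l * b 0%N + m * a 0%N) * w x); first ring.
by rewrite h oppr0 mul0r.
Qed.

Lemma comp_resolvent f : comp_op hp1 (resolvent f) - lam *: resolvent f = f.
Proof.
apply/val_inj/funext => x /=.
change (resolvent_fun f p.[x] - lam * resolvent_fun f x = f x).
rewrite /resolvent_fun !shift_a // !shift_b //.
rewrite /u /v /=; case: (f x) => fr fi /=.
have -> : lam = Complex l m by rewrite /l /m; case: (lam).
by apply/eqP; rewrite eq_complex /=; apply/andP; split; apply/eqP; ring.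
Qed.

(** Applying the series commutes with composition by p, so this reduces to
[comp_resolvent] by linearity. *)
Lemma resolvent_comp f : resolvent (comp_op hp1 f - lam *: f) = f.
Proof.
rewrite -[RHS]comp_resolvent; apply/val_inj/funext => x /=.
change (resolvent_fun (comp_op hp1 f - lam *: f) x =
  resolvent_fun f p.[x] - lam * resolvent_fun f x).
have uE : u (comp_op hp1 f - lam *: f) = fun y => u f p.[y] - (l * u f y - m * v f y).
  apply/funext => y; rewrite /u /v /l /m.
  change (complex.Re (f p.[y] - lam * f y) = complex.Re (f p.[y]) -
    (complex.Re lam * complex.Re (f y) - complex.Im lam * complex.Im (f y))).
  by case: (f p.[y]) (lam) (f y) => ? ? [? ?] [? ?].
have vE : v (comp_op hp1 f - lam *: f) =
    fun y => v f p.[y] - (l * v f y - - m * u f y).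
  apply/funext => y; rewrite /u /v /l /m.
  change (complex.Im (f p.[y] - lam * f y) = complex.Im (f p.[y]) -
    (complex.Re lam * complex.Im (f y) - - complex.Im lam * complex.Re (f y))).
  case: (f p.[y]) (lam) (f y) => ? ? [? ?] [? ?] /=; ring.
rewrite /resolvent_fun uE vE /E !(iter_series_lin hp nf r0 r0) // -/E.
have -> : lam = Complex l m by rewrite /l /m; case: (lam).
by apply/eqP; rewrite eq_complex /=; apply/andP; split; apply/eqP; ring.
Qed.

(** The weight of exponent N and the jet of order N dominate all the seminorms
with indices at most N, so one pair of indices serves for all of them; this is
what a neighbourhood of 0 asks for. *)
Lemma resolvent_seminorm_le N : exists N' C, 0 <= C /\ forall f M,
  (forall k n, (k <= N')%N -> (n <= N')%N -> seminorm k n f <= M) ->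
  forall k n, (k <= N)%N -> (n <= N)%N -> seminorm k n (resolvent f) <= C * M.
Proof.
have [k' [C [C0 hC]]] := iter_series_jet hp nf r0 r0 N N.
pose N' := maxn k' N.
exists N', (4 * (C * (2 ^+ N' * 2))); split; first by rewrite !mulr_ge0 ?exprn_ge0.
move=> f M hM k n kN nN.
have wM i j y : (i <= N')%N -> (j <= N')%N -> weighted i j f y <= M.
  by move=> iN jN; apply: le_trans (hM i j iN jN); exact: le_seminorm.
have jetN w : (forall i j y, (i <= N')%N -> (j <= N')%N ->
      `|y| ^+ i * `|derive1n j w y| <= M) ->
    forall y, jet_le N w y (2 ^+ N' * (2 * M) / wt y ^+ k').
  move=> hw y; apply: jet_leWk (leq_maxl k' N) _; rewrite -/N'.
  by apply: jet_le_weights => i j z iN jN; apply: hw => //; exact: leq_trans jN (leq_maxr _ _).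
have ju := jetN (u f) (fun i j y iN jN => le_trans (ler_wpM2l (exprn_ge0 i (normr_ge0 y))
  (Re_le_normc (cderiven j f y))) (wM i j y iN jN)).
have jv := jetN (v f) (fun i j y iN jN => le_trans (ler_wpM2l (exprn_ge0 i (normr_ge0 y))
  (Im_le_normc (cderiven j f y))) (wM i j y iN jN)).
pose T := C * (2 ^+ N' * (2 * M)).
have T0 : 0 <= T.
  have := jet_le_ge0 (hC a _ _ slow_a (su f) ju 0).
  by rewrite /wt normr0 addr0 expr1n divr1.
have bd c w : (forall n, `|c n| <= r * r ^+ n) -> rschwartz w ->
    (forall y, jet_le N w y (2 ^+ N' * (2 * M) / wt y ^+ k')) ->
    forall x, `|derive1n n (E c w) x| <= T / wt x ^+ N.
  by move=> sc sw jw x; exact: hC sc sw jw x n nN.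
have wN (x : R) : 0 < wt x ^+ N by rewrite exprn_gt0// wt_gt0.
apply: seminorm_le => x; rewrite /weighted.
have -> : 4 * (C * (2 ^+ N' * 2)) * M = wt x ^+ N * (4 * (T / wt x ^+ N)).
  by rewrite /T; field; rewrite gt_eqF.
apply: ler_pM; rewrite ?exprn_ge0 ?normr_ge0//; first by rewrite sqrtr_ge0.
  apply: (@le_trans _ _ (wt x ^+ k)); last by rewrite ler_weXn2l// wt_ge1.
  by rewrite lerXn2r ?nnegrE ?wt_ge0// /wt lerDr.
apply: (le_trans (normc_le_cnorm1 _)); rewrite /cnorm1 /cderiven /=.
have sm c w : (forall n, `|c n| <= r * r ^+ n) -> rschwartz w -> rsmooth (E c w).
  by move=> sc sw; have [] := Er sc sw.
have sEb : rsmooth (-1 *: E b (v f)) by have [] := rschwartzZ (-1) (Er slow_b (sv f)).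
have -> : derive1n n (@complex.Re R \o resolvent_fun f) x =
    derive1n n (E a (u f)) x - derive1n n (E b (v f)) x.
  rewrite ReE (derive1nD n (sm _ _ slow_a (su f)) sEb).
  by rewrite (derive1nZ _ n (sm _ _ slow_b (sv f))) scaleN1r.
have -> : derive1n n (@complex.Im R \o resolvent_fun f) x =
    derive1n n (E a (v f)) x + derive1n n (E b (u f)) x.
  by rewrite ImE (derive1nD n (sm _ _ slow_a (sv f)) (sm _ _ slow_b (su f))).
have h1 := bd a _ slow_a (su f) ju x; have h2 := bd b _ slow_b (sv f) jv x.
have h3 := bd a _ slow_a (sv f) jv x; have h4 := bd b _ slow_b (su f) ju x.
have := ler_normB (derive1n n (E a (u f)) x) (derive1n n (E b (v f)) x).
have := ler_normD (derive1n n (E a (v f)) x) (derive1n n (E b (u f)) x).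
lra.
Qed.

Lemma resolvent_continuous : linear resolvent -> continuous resolvent.
Proof.
move=> lin f A; rewrite /= !nbhs_schwartzE => -[N [e [e0 hA]]].
have [N' [C [C0 hC]]] := resolvent_seminorm_le N.
have d0 : 0 < e / (C + 1) by rewrite divr_gt0//; lra.
exists N', (e / (C + 1)); split=> // g hg; apply: hA => k n kN nN.
have -> : resolvent g - resolvent f = resolvent (g - f).
  have -> : g - f = (-1) *: f + g by rewrite scaleN1r addrC.
  by rewrite lin scaleN1r addrC.
have := hC (g - f) (e / (C + 1)) (fun k n kN nN => ltW (hg k n kN nN)) k n kN nN.
move=> /le_lt_trans; apply; rewrite mulrA ltr_pdivrMr; lra.
Qed.

Lemma not_in_spectrum : ~ spectrum (comp_op hp1) lam.
Proof.
apply; have lin : linear resolvent.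
  move=> c f g; set F := resolvent f; set G := resolvent g.
  rewrite -[RHS]resolvent_comp; congr resolvent.
  rewrite linearP scalerDr scalerA (mulrC lam c) -scalerA opprD addrACA -scalerBr.
  by rewrite !comp_resolvent.
pose mx := GRing.isLinear.Build R[i] (schwartzSpace R) (schwartzSpace R) _ resolvent lin.
pose S : {linear schwartzSpace R -> schwartzSpace R} := HB.pack resolvent mx.
exists S; split; first exact: resolvent_continuous.
- exact: resolvent_comp.
- exact: comp_resolvent.
Qed.

End Resolvent.

(** * Separating points by a Gaussian *)

Section Gaussian.
Variable R : realType.
Implicit Types (x : R) (q : {poly R}).

Definition gaussian x : R := expR (- x ^+ 2).

Lemma derive1_gaussian q : (forall x, derivable (fun x => q.[x] * gaussian x) x 1) /\
  derive1 (fun x => q.[x] * gaussian x) =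
    (fun x => (deriv q - q * ('X + 'X)).[x] * gaussian x).
Proof.
have D x : is_derive x (1 : R) (fun x => q.[x] * gaussian x)
    ((deriv q - q * ('X + 'X)).[x] * gaussian x).
  have dg : is_derive x (1 : R) gaussian (- (x + x) * gaussian x).
    have -> : gaussian = expR \o horner (- 'X^2).
      by apply/funext => y; rewrite /gaussian /= !hornerE.
    have := is_derive1_comp (is_derive_expR (- 'X^2).[x]) (is_derive_poly (- 'X^2) x).
    move/is_derive_eq; apply.
    rewrite /GRing.scale/= derivN derivXn !hornerN hornerMn /=.
    by rewrite expr1 hornerX mulr2n mulrC.
  have := is_deriveM (is_derive_poly q x) dg.
  move/is_derive_eq; apply.
  by rewrite /GRing.scale/= hornerD hornerN hornerM hornerD hornerX; ring.
split=> [x|]; first exact: (@ex_derive _ _ _ _ _ _ _ (D x)).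
by apply/funext => x; rewrite derive1E; exact: (@derive_val _ _ _ _ _ _ _ (D x)).
Qed.

(** The exponential series gives exp y >= y^(D+1) / (D+1)!; it is applied with
y = 1 + x^2, for which wt x <= 2 y. *)
Lemma rdecr_gaussian q : rdecr (fun x => q.[x] * gaussian x).
Proof.
move=> k; have [K [D [K0 hK]]] := horner_le_wt ('X^k * q).
exists (K * (2 ^+ D * (D.+1`!%:R * expR 1))) => x.
have g0 : 0 <= gaussian x by exact: expR_ge0.
rewrite normrM (ger0_norm g0) [X in X <= _]mulrA.
have -> : `|x| ^+ k * `|q.[x]| = `|('X^k * q).[x]| by rewrite !hornerE normrM normrX.
apply: (le_trans (ler_wpM2r g0 (hK x))); rewrite -mulrA ler_wpM2l//.
rewrite /gaussian expRN ler_pdivrMr ?expR_gt0// -!mulrA -expRD.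
set y := 1 + x ^+ 2; have y1 : 1 <= y by rewrite lerDl sqr_ge0.
have wy : wt x <= 2 * y.
  rewrite /wt /y -[x ^+ 2]real_normK ?num_real//; set z := `|x|.
  have : 0 <= (z - 1) ^+ 2 by exact: sqr_ge0.
  have := sqr_ge0 z; rewrite sqrrB1 => h1 h2; lra.
apply: (@le_trans _ _ ((2 * y) ^+ D)).
  by rewrite lerXn2r ?nnegrE ?wt_ge0//; lra.
rewrite exprMn ler_wpM2l ?exprn_ge0// mulrC -ler_pdivrMr ?ltr0n ?fact_gt0//.
apply: (@le_trans _ _ (y ^+ D.+1 / D.+1`!%:R)).
  by rewrite ler_wpM2r ?invr_ge0// ler_weXn2l.
apply: le_trans (expR_ge1Dxn D _); last by lra.
by rewrite lerDr.
Qed.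

Lemma rschwartz_gaussian : rschwartz gaussian.
Proof.
have H n : exists q, derive1n n gaussian = (fun x => q.[x] * gaussian x).
  elim: n => [|n [q IH]].
    by exists 1; apply/funext => x; rewrite hornerE mul1r.
  by rewrite derive1nS IH; exists (deriv q - q * ('X + 'X)); exact: (derive1_gaussian q).2.
by split=> n; have [q ->] := H n; [exact: (derive1_gaussian q).1|exact: rdecr_gaussian].
Qed.

Lemma schwartz_separates (a b : R) : a <> b ->
  exists f : schwartzSpace R, f a <> f b.
Proof.
move=> ab.
have hs : rschwartz (gaussian \o horner ('X - a%:P)).
  by apply: rschwartz_comp; [rewrite size_XsubC|exact: rschwartz_gaussian].
have mem : (fun x => (gaussian (x - a) +i* 0)%C) \in schwartz (R := R).
  apply/schwartzP; split.
    rewrite (_ : _ \o _ = gaussian \o horner ('X - a%:P))//.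
    by apply/funext => x; rewrite /= !hornerE.
  rewrite (_ : _ \o _ = 0 *: (gaussian \o horner ('X - a%:P))); first exact: rschwartzZ.
  by apply/funext => x; rewrite scale0r.
exists (SchwartzFun mem) => /= -[].
rewrite subrr /gaussian expr0n oppr0 => /expR_inj/esym/eqP.
rewrite oppr_eq0 sqrf_eq0 subr_eq0 => /eqP ba; exact/ab.
Qed.

End Gaussian.

(** * The spectrum *)

(** If p.[x] = p.[y], every function in the range takes equal values at x and y,
so the range is not everything. *)
Lemma not_injective_in_spectrum (R : realType) (p : {poly R}) (hp : (1 < size p)%N)
  (x y : R) : x <> y -> p.[x] = p.[y] -> spectrum (comp_op hp) 0.
Proof.
move=> xy pxy [S [_ _ SK]].
have [f] := schwartz_separates xy; apply.
have fE z : f z = S f p.[z].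
  by rewrite -{1}[f](SK f) /= scale0r subr0.
by rewrite !fE pxy.
Qed.

Lemma even_degree_gt1 (R : realType) (p : {poly R}) :
  ~~ odd (size p).-1 -> (1 < size p)%N -> (2 < size p)%N.
Proof. by case: (size p) => [|[|[|]]]. Qed.

Theorem theorem2p5 (R : realType) (phi : {poly R})
    (phi_even : ~~ odd (size phi).-1)
    (phi_nofix : forall x : R, phi.[x] <> x) :
  spectrum (comp_op (nofix_nonconstant phi_nofix)) = [set 0].
Proof.
have hp := even_degree_gt1 phi_even (nofix_nonconstant phi_nofix).
apply/seteqP; split=> lam /=.
  move=> hlam; apply/eqP; apply: contrapT => /negP lam0.
  exact: not_in_spectrum hp phi_nofix _ lam0 hlam.
move=> ->; have [C C0 hC] := wt_sq_le_horner hp.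
have [x [y [xy pxy]]] := not_injective C0 (@continuous_horner _ phi) phi_nofix hC.
exact: not_injective_in_spectrum xy pxy.
Qed.
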